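(* Let $k\in\mathbb{N}_0$. Let $S_a$ be a non-singular subdivision scheme on $\mathbb{Z}^s$ with dilation matrix $mI$, $|m|\ge 2$, with symbol $a(z)$, and with associated parameter values $t_\alpha^{(r)}=t_0^{(r)}+\alpha/m^r$, $t_0^{(r)}=t_0^{(r-1)}-\tau/m^r$, $t_0^{(0)}=0$, for some $\tau\in\mathbb{R}^s$. Then $S_a$ (with these parameter values) reproduces polynomials of degree up to $k$ if and only if $$\bigl(D^{j}a\bigr)(\mathbf 1)=|m|^s\,q_{j}(\tau)\quad\text{and}\quad \bigl(D^{j}a\bigr)(\varepsilon)=0\ \text{ for all } \varepsilon\in\Xi',$$ for all $j\in\mathbb{N}_0^s$ with $|j|\le k$.
   Context: Fix $s\ge 1$ and an integer $m$ with $|m|\ge 2$. A mask is a finitely supported sequence $a=\{a_\alpha\in\mathbb{R}:\alpha\in\mathbb{Z}^s\}$. Its symbol is the Laurent polynomial $a(z)=\sum_{\alpha\in\mathbb{Z}^s}a_\alpha z^\alpha$, $z\in(\mathbb{C}\setminus\{0\})^s$, where $z^\alpha=z_1^{\alpha_1}\cdots z_s^{\alpha_s}$. Let $\ell(\mathbb{Z}^s)$ be the space of all real sequences indexed by $\mathbb{Z}^s$. The subdivision operator is $(S_a d)_\alpha=\sum_{\beta\in\mathbb{Z}^s}a_{\alpha-m\beta}\,d_\beta$ for $d\in\ell(\mathbb{Z}^s)$. The subdivision scheme $S_a$ is the recursion $d^{(r+1)}=S_a d^{(r)}$, $r\ge 0$, $d^{(0)}\in\ell(\mathbb{Z}^s)$.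 Parameter values: for $\tau\in\mathbb{R}^s$, the parameter values are the points $t_\alpha^{(r)}=t_0^{(r)}+\alpha/m^r\in\mathbb{R}^s$ ($\alpha\in\mathbb{Z}^s$, $r\ge 0$), where $t_0^{(0)}=0$ and $t_0^{(r)}=t_0^{(r-1)}-\tau/m^r$ for $r\ge 1$. The datum $d_\alpha^{(r)}$ is attached to the point $t_\alpha^{(r)}$. Convergence: for initial data $d=d^{(0)}$ the scheme has limit function $g_d$ if there are continuous functions $F^{(r)}:\mathbb{R}^s\to\mathbb{R}$ with $F^{(r)}(t_\alpha^{(r)})=d_\alpha^{(r)}$ for all $\alpha\in\mathbb{Z}^s$, $r\ge 0$, which converge uniformly on compact sets to $g_d$ as $r\to\infty$. One writes $S_a^\infty d=g_d$. The scheme is convergent if a limit function exists for every $d\in\ell(\mathbb{Z}^s)$. It is non-singular if it is convergent and $g_d=0$ if and only if $d$ is the zero sequence. Reproduction: let $\Pi_k$ be the space of real polynomials on $\mathbb{R}^s$ of total degree at most $k$. A convergent scheme with parameter values $\{t^{(r)}\}$ reproduces polynomials of degree up to $k$ if for every $\pi\in\Pi_k$ and initial data $p^{(0)}_\alpha=\pi(t^{(0)}_\alpha)$, $\alpha\in\mathbb{Z}^s$, one has $S_a^\infty p^{(0)}=\pi$. Further notation: $D^j$, $j\in\mathbb{N}_0^s$, is the partial derivative of multi-order $j$, and $|j|=j_1+\dots+j_s$. Put $\mathbf 1=(1,\dots,1)$, $E=\{0,\dots,|m|-1\}^s$, $\Xi=\{(e^{-2\pi i e_1/m},\dots,e^{-2\pi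 i e_s/m}): (e_1,\dots,e_s)\in E\}$ and $\Xi'=\Xi\setminus\{\mathbf 1\}$. For $j\in\mathbb{N}_0^s$ put $q_{j}(z_1,\dots,z_s)=\prod_{i=1}^s\prod_{\ell=0}^{j_i-1}(z_i-\ell)$, with empty products equal to $1$ (so $q_0=1$). *)

(* Defs.v *)
(* The real numbers are an arbitrary [R : realType], the complex numbers are
   [R[i]], and points of R^s, C^s and Z^s are row vectors. *)
From HB Require Import structures.
From mathcomp Require Import all_boot all_order all_algebra.
From mathcomp Require Import all_classical all_reals all_analysis.
From mathcomp Require Import complex.
(* Importing the notations of mpoly would clash with those of analysis. *)
From mathcomp Require Import -(notations) mpoly.

Set Implicit Arguments.
Unset Strict Implicit.
Unset Printing Implicit Defensive.

Import Order.TTheory GRing.Theory Num.Theory.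
Import numFieldNormedType.Exports.

Local Open Scope classical_set_scope.
Local Open Scope ring_scope.
Local Open Scope complex_scope.

Definition is_mask (R : realType) (s : nat) (a : 'rV[int]_s -> R) : Prop :=
  finite_set [set alpha | a alpha != 0].

(* [\sum_(x \in A) F x] adds the finitely many nonzero values of [F] on [A].
   In [symbol] and [subdiv] the summands have finite support when [a] is a mask
   and [m != 0].  [symbol] is meaningful only at points with nonzero
   coordinates, where negative powers are not affected by [0^-1 = 0]. *)
Definition symbol (R : realType) (s : nat) (a : 'rV[int]_s -> R)
    (z : 'rV[R[i]]_s) : R[i] :=
  \sum_(alpha \in [set: 'rV[int]_s])
     ((a alpha)%:C * \prod_(i < s) z 0 i ^ alpha 0 i).

Definition subdiv (R : realType) (s : nat) (m : int) (a : 'rV[int]_s -> R)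
    (d : 'rV[int]_s -> R) : 'rV[int]_s -> R :=
  fun alpha => \sum_(beta \in [set: 'rV[int]_s]) (a (alpha - m *: beta) * d beta).

Definition iter_subdiv (R : realType) (s : nat) (m : int)
    (a : 'rV[int]_s -> R) (d : 'rV[int]_s -> R) (r : nat) : 'rV[int]_s -> R :=
  iter r (subdiv m a) d.

Fixpoint param0 (R : realType) (s : nat) (m : int) (tau : 'rV[R]_s) (r : nat) :
    'rV[R]_s :=
  if r is r'.+1 then param0 m tau r' - (m%:~R ^+ r)^-1 *: tau else 0.

Definition param (R : realType) (s : nat) (m : int) (tau : 'rV[R]_s) (r : nat)
    (alpha : 'rV[int]_s) : 'rV[R]_s :=
  param0 m tau r + (m%:~R ^+ r)^-1 *: map_mx intr alpha.

Definition limit_function (R : realType) (s : nat) (m : int)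
    (a : 'rV[int]_s -> R) (tau : 'rV[R]_s)
    (d : 'rV[int]_s -> R) (g : 'rV[R]_s -> R) : Prop :=
  exists F : nat -> 'rV[R]_s -> R,
    [/\ forall r, continuous (F r),
        forall r alpha, F r (param m tau r alpha) = iter_subdiv m a d r alpha &
        {family compact, F @ \oo --> g}].

Definition convergent (R : realType) (s : nat) (m : int)
    (a : 'rV[int]_s -> R) (tau : 'rV[R]_s) : Prop :=
  forall d, exists g, limit_function m a tau d g.

Definition non_singular (R : realType) (s : nat) (m : int)
    (a : 'rV[int]_s -> R) (tau : 'rV[R]_s) : Prop :=
  convergent m a tau /\
  forall d g, limit_function m a tau d g ->
    ((forall x, g x = 0) <-> (forall alpha, d alpha = 0)).

(* [mpoly.msize p] is one plus the total degree of [p], and 0 if [p] is 0. *)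
Definition reproduces_polynomials (R : realType) (s : nat) (m : int)
    (a : 'rV[int]_s -> R) (tau : 'rV[R]_s) (k : nat) : Prop :=
  forall p : mpoly s R, (msize p <= k.+1)%N ->
    let p_fun := fun x : 'rV[R]_s => meval (x 0) p in
    limit_function m a tau (fun alpha => p_fun (param m tau 0 alpha)) p_fun.

Definition partial (K : numFieldType) (s : nat) (i : 'I_s)
    (f : 'rV[K]_s -> K) : 'rV[K]_s -> K :=
  fun z => 'D_(delta_mx 0 i) f z.

(* D^j = D_0^(j 0) o ... o D_(s-1)^(j (s-1)), with D_i the derivative in the
   i-th coordinate; for K = R[i] these are complex derivatives. *)
Definition mpartial (K : numFieldType) (s : nat) (j : {ffun 'I_s -> nat})
    (f : 'rV[K]_s -> K) : 'rV[K]_s -> K :=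
  foldr (fun i g => iter (j i) (partial i) g) f (enum 'I_s).

Definition qprod (R : realType) (s : nat) (j : {ffun 'I_s -> nat})
    (z : 'rV[R]_s) : R :=
  \prod_(i < s) \prod_(l < j i) (z 0 i - l%:R).

Definition expi (R : realType) (theta : R) : R[i] :=
  (cos theta) +i* (sin theta).

Definition Xi (R : realType) (s : nat) (m : int) : set 'rV[R[i]]_s :=
  [set z | exists e : {ffun 'I_s -> 'I_`|m|%N},
     z = \row_i expi (- (2 * pi * (e i)%:R / m%:~R))].

Definition Xi' (R : realType) (s : nat) (m : int) : set 'rV[R[i]]_s :=
  Xi m `\ const_mx 1.

(* Main.v *)
Require Import Defs.
From HB Require Import structures.
From mathcomp Require Import all_boot all_order all_algebra.
From mathcomp Require Import all_classical all_reals all_analysis.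
From mathcomp Require Import complex.
From mathcomp Require Import ring lra zify.
From mathcomp Require Import -(notations) mpoly.

Import Order.TTheory GRing.Theory Num.Theory.
Import numFieldNormedType.Exports.

Local Open Scope classical_set_scope.
Local Open Scope ring_scope.
Local Open Scope complex_scope.

Set Implicit Arguments.
Unset Strict Implicit.

(** Why the theorem holds.  The scheme is self-similar: running it from the
    data [S_a d] amounts to running it from [d] with one level skipped, so if
    [d] has the limit function [g], then [S_a d] has the limit function
    [x |-> g ((x - tau) / m)] ([limit_function_subdiv]).  Let the scheme
    reproduce degree [k] and let [f] be a polynomial of degree at most [k].
    The data [S_a f] and the samples on Z^s of the polynomial
    [f ((. - tau) / m)] then have the same limit function, and non-singularity
    makes them equal:
<<
      S_a f (alpha) = f ((alpha - tau) / m)   for all alpha in Z^s.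
>>
    Conversely this identity can be iterated: it says that all refined data are
    samples of [f] at the parameter values, so [f] itself interpolates every
    level ([reproduces_subdivP]).

    The rest is algebra on a finitely supported mask.  In [S_a f (alpha)] only
    the [a gamma] with [gamma] congruent to [alpha] modulo [m] occur, and the
    affine substitution [x |-> alpha - m x] preserves degrees; the identity
    therefore says that on each residue class the functional
    [f |-> sum a_gamma f(gamma)] is evaluation at [tau] on polynomials of degree
    at most [k] ([subdiv_coset_sumP]).  It is enough to test the products [q_j]
    of falling factorials, because Stirling numbers of the second kind express
    monomials in them without raising the degree ([coset_momentsP]).

    Falling factorials are the right basis because
    [D^j a (z) = z^(-j) sum a_gamma q_j(gamma) z^gamma] ([mpartial_laurent]).
    At the points of Xi the values of [z^j D^j a] are thus the discrete Fourier
    transform, over (Z/mZ)^s, of the residue class sums of [a_gamma q_j(gamma)].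
    These sums are all equal to [q_j(tau)] exactly when the transform is
    [|m|^s q_j(tau)] at the trivial character and zero elsewhere
    ([coset_sums_fourierP]), which is the stated condition on the symbol
    ([symbol_conditionsP]). *)

(** * Subdivision as a sum over a residue class *)

Definition congr_mod (s : nat) (m : int) (alpha gamma : 'rV[int]_s) :=
  [forall i, (m %| (alpha 0 i - gamma 0 i)%R)%Z].

Definition mask_support (R : realType) (s : nat) (a : 'rV[int]_s -> R) :
    seq 'rV[int]_s := finmap.enum_fset (fset_set [set alpha | a alpha != 0]).

Section Masks.
Context {R : realType} {s : nat} {m : int} {a : 'rV[int]_s -> R}.
Hypotheses (m0 : m != 0) (ha : is_mask a).

Lemma mask_support_uniq : uniq (mask_support a).
Proof. exact: finmap.fset_uniq. Qed.

Lemma notin_mask_support gamma : gamma \notin mask_support a -> a gamma = 0.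
Proof. by rewrite in_fset_set// notin_setE /= => /negP/negPn/eqP. Qed.

(** The substitution [gamma = alpha - m beta] turns the sum over all [beta]
    into a finite sum over the residue class of [alpha], where the division by
    [m] is exact. *)
Lemma subdivE d alpha :
  subdiv m a d alpha = \sum_(gamma <- mask_support a | congr_mod m alpha gamma)
    a gamma * d (map_mx (divz^~ m) (alpha - gamma)).
Proof.
pose h beta : 'rV[int]_s := alpha - m *: beta.
have hK beta : map_mx (divz^~ m) (alpha - h beta) = beta.
  by rewrite /h subKr; apply/rowP => i; rewrite !mxE mulrC mulzK.
rewrite bigfs ?mask_support_uniq//; last first.
  by move=> i _ /notin_mask_support ->; rewrite mul0r.
have -> : [set` congr_mod m alpha] = h @` setT.
  apply/seteqP; split=> [gamma /= /forallP H|gamma /= [beta _ <-]].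
    exists (map_mx (divz^~ m) (alpha - gamma)) => //; apply/rowP => i.
    by rewrite /h !mxE mulrC divzK ?subKr//.
  by apply/forallP => i; rewrite /h !mxE subKr dvdz_mulr.
rewrite fsbig_image; last by move=> x y _ _ xy; rewrite -(hK x) xy hK.
by rewrite /subdiv; apply: eq_fsbigr => beta _; rewrite hK.
Qed.

Lemma subdiv_restr (f : 'rV[R]_s -> R) alpha :
  subdiv m a (fun beta => f (map_mx intr beta)) alpha =
  \sum_(gamma <- mask_support a | congr_mod m alpha gamma)
    a gamma * f (m%:~R^-1 *: (map_mx intr alpha - map_mx intr gamma)).
Proof.
rewrite subdivE; apply: eq_bigr => gamma /forallP H.
congr (_ * f _); apply/rowP => i; rewrite !mxE.
have mR0 : m%:~R != 0 :> R by rewrite intr_eq0.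
by apply: (mulfI mR0); rewrite mulVKf// -intrM mulrC divzK// intrB.
Qed.

Lemma iter_subdivB d1 d2 r alpha :
  iter_subdiv m a (d1 \- d2) r alpha =
  iter_subdiv m a d1 r alpha - iter_subdiv m a d2 r alpha.
Proof.
elim: r alpha => [//|r IH] alpha.
rewrite /iter_subdiv !iterS -!/(iter_subdiv _ _ _ _) !subdivE -sumrB.
by apply: eq_bigr => gamma _; rewrite IH mulrBr.
Qed.

End Masks.

(** * Limit functions *)

Lemma cvg_compactP (R : realType) (s : nat) (F : nat -> 'rV[R]_s -> R)
    (g : 'rV[R]_s -> R) :
  {family compact, F @ \oo --> g} <->
  (forall A, compact A -> forall e, 0 < e ->
     \forall n \near \oo, forall x, A x -> `|g x - F n x| < e).
Proof.
split=> [/fam_cvgP cvgF A cA e e0|H].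
  have := cvgF A cA [set h | forall y, A y -> `|g y - h y| < e].
  apply; apply/uniform_nbhs.
  exists [set xy | ball xy.1 e xy.2]; split.
    by rewrite -entourage_ballE; exists e.
  by move=> h /= + y Ay => /(_ y Ay); rewrite -ball_normE.
apply/fam_cvgP => A cA P /uniform_nbhs[E [entE EP]].
have [e /= e0 eE] : exists2 e, 0 < e &
    [set xy : R * R | ball xy.1 e xy.2] `<=` E.
  by move: entE; rewrite -entourage_ballE => -[e e0 eE]; exists e.
apply: filterS (H A cA e e0) => n Hn; apply: EP => y Ay; apply: eE => /=.
by rewrite -ball_normE /=; exact: Hn.
Qed.

Lemma limit_functionB (R : realType) (s : nat) (m : int)
    (a : 'rV[int]_s -> R) (tau : 'rV[R]_s) d1 d2 g1 g2 :
  m != 0 -> is_mask a ->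
  limit_function m a tau d1 g1 -> limit_function m a tau d2 g2 ->
  limit_function m a tau (d1 \- d2) (g1 \- g2).
Proof.
move=> m0 ha [F1 [c1 i1 /cvg_compactP l1]] [F2 [c2 i2 /cvg_compactP l2]].
exists (fun r => F1 r \- F2 r); split.
- by move=> r x; apply: continuousB; [exact: (c1 r x)|exact: (c2 r x)].
- by move=> r alpha /=; rewrite i1 i2 iter_subdivB.
- apply/cvg_compactP => A cA e e0.
  have e20 : 0 < e / 2 by rewrite divr_gt0.
  near=> n => x Ax /=.
  have -> : g1 x - g2 x - (F1 n x - F2 n x) =
    (g1 x - F1 n x) - (g2 x - F2 n x) by ring.
  rewrite (le_lt_trans (ler_normB _ _))// [e]splitr ltrD//.
    by move: x Ax; near: n; exact: l1.
  by move: x Ax; near: n; exact: l2.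
Unshelve. all: by end_near. Qed.

Lemma param_level0 (R : realType) (s : nat) (m : int) (tau : 'rV[R]_s) alpha :
  param m tau 0 alpha = map_mx intr alpha.
Proof. by rewrite /param /= expr0 invr1 scale1r add0r. Qed.

(** The shift [t_0^(r)] is [- tau (1/m + ... + 1/m^r)], so one more level is
    the same affine contraction at every level. *)
Lemma param_shift (R : realType) (s : nat) (m : int) (tau : 'rV[R]_s) r alpha :
  param m tau r.+1 alpha = m%:~R^-1 *: (param m tau r alpha - tau).
Proof.
have H0 : forall r, param0 m tau r.+1 = m%:~R^-1 *: (param0 m tau r - tau).
  elim=> [|n IH]; first by rewrite /= !sub0r expr1 scalerN.
  rewrite -[LHS]/(param0 m tau n.+1 - (m%:~R ^+ n.+2)^-1 *: tau) {1}IH.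
  rewrite -[param0 m tau n.+1]/(param0 m tau n - (m%:~R ^+ n.+1)^-1 *: tau).
  by rewrite [m%:~R ^+ n.+2]exprS invfM !scalerBr !scalerA addrAC.
rewrite /param H0 exprS invfM -scalerA -scalerDr.
by rewrite addrAC.
Qed.

(** Level [r] of the scheme started from [subdiv m a d] is level [r + 1] of the
    scheme started from [d], read through the contraction of [param_shift]. *)
Lemma limit_function_subdiv (R : realType) (s : nat) (m : int)
    (a : 'rV[int]_s -> R) (tau : 'rV[R]_s) d g : m != 0 ->
  limit_function m a tau d g ->
  limit_function m a tau (subdiv m a d) (fun x => g (m%:~R^-1 *: (x - tau))).
Proof.
move=> m0 [F [cF iF /cvg_compactP lF]].
pose A x : 'rV[R]_s := m%:~R^-1 *: (x - tau).
have cA : continuous A.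
  move=> x.
  refine (@continuousZ R 'rV[R]_s 'rV[R]_s (fun=> _) (fun y => y - tau) x _ _).
    exact: cst_continuous.
  refine (@continuousB R 'rV[R]_s 'rV[R]_s id (fun=> tau) x _ _).
    by move=> P; rewrite nbhs_filterE.
  exact: cst_continuous.
exists (fun r => F r.+1 \o A); split.
- by move=> r x; apply: continuous_comp; [exact: cA|exact: cF].
- by move=> r alpha; rewrite /= /A -param_shift iF /iter_subdiv iterSr.
- apply/cvg_compactP => K cK e e0.
  have cAK : compact (A @` K).
    by apply: continuous_compact => //; exact: continuous_subspaceT.
  have [N _ HN] := lF _ cAK e e0.
  exists N => // n /= Nn x Kx; apply: HN; last by exists x.
  by rewrite /= (leq_trans Nn).
Qed.

(** * Polynomial functions of bounded total degree *)

Definition polyfun (R : realType) (s k : nat) (f : 'rV[R]_s -> R) :=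
  exists2 p : mpoly s R, (msize p <= k.+1)%N & forall x, f x = meval (x 0) p.

Section PolynomialFunctions.
Context {R : realType} {s : nat}.
Implicit Types (f g : 'rV[R]_s -> R) (k l : nat).

Lemma polyfun_cst c : polyfun 0 (fun=> c : R) (s := s).
Proof.
exists (mpolyC s c); last by move=> x; rewrite mevalC.
by rewrite msizeC; case: (c != 0).
Qed.

Lemma polyfun_coord i : polyfun 1 (fun x : 'rV[R]_s => x 0 i).
Proof.
exists (mpolyX R (mnm1 i)); first by rewrite msizeX mdeg1.
by move=> x; rewrite mevalXU.
Qed.

Lemma polyfun_leq k l f : (k <= l)%N -> polyfun k f -> polyfun l f.
Proof. by move=> kl [p pk fE]; exists p => //; rewrite (leq_trans pk). Qed.

Lemma polyfunD k f g : polyfun k f -> polyfun k g -> polyfun k (f \+ g).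
Proof.
move=> [p pk fE] [q qk gE]; exists (p + q); last first.
  by move=> x; rewrite mevalD -fE -gE.
by rewrite (leq_trans (mmeasureD_le _ _ _))// geq_max pk.
Qed.

Lemma polyfunM k l f g :
  polyfun k f -> polyfun l g -> polyfun (k + l) (f \* g).
Proof.
move=> [p pk fE] [q qk gE]; exists (p * q); last first.
  by move=> x; rewrite mevalM -fE -gE.
have [->|p0] := eqVneq p 0; first by rewrite mul0r msize0.
have [->|q0] := eqVneq q 0; first by rewrite mulr0 msize0.
move: (leq_add pk qk); rewrite msizeM//.
by case: (msize p + msize q)%N => [|n]; rewrite ?addSn ?addnS.
Qed.

Lemma polyfun_sum k (I : Type) (r : seq I) (F : I -> 'rV[R]_s -> R) :
  (forall i, polyfun k (F i)) -> polyfun k (fun x => \sum_(i <- r) F i x).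
Proof.
move=> HF; elim: r => [|i r IH].
  under eq_fun do rewrite big_nil.
  exact: polyfun_leq (polyfun_cst 0).
by under eq_fun do rewrite big_cons; exact: polyfunD.
Qed.

Lemma polyfun_prod (I : Type) (r : seq I) (d : I -> nat)
    (F : I -> 'rV[R]_s -> R) :
  (forall i, polyfun (d i) (F i)) ->
  polyfun (\sum_(i <- r) d i) (fun x => \prod_(i <- r) F i x).
Proof.
move=> HF; elim: r => [|i r IH].
  by rewrite big_nil; under eq_fun do rewrite big_nil; exact: polyfun_cst.
rewrite big_cons.
have -> : (fun x => \prod_(j <- i :: r) F j x) =
    F i \* fun x => \prod_(j <- r) F j x.
  by apply/funext => x; rewrite big_cons.
exact: polyfunM.
Qed.

Lemma polyfun_exp k f n :
  polyfun k f -> polyfun (n * k) (fun x => f x ^+ n).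
Proof.
move=> Pf; elim: n => [|n IH].
  by under eq_fun do rewrite expr0; exact: polyfun_cst.
by under eq_fun do rewrite exprS; exact: polyfunM.
Qed.

Lemma polyfun_affine (c : R) (b : 'rV[R]_s) k f :
  polyfun k f -> polyfun k (fun x => f (c *: x + b)).
Proof.
move=> [p pk fE].
under eq_fun do rewrite fE mevalE big_seq.
suff H : forall mu, polyfun k (fun x : 'rV[R]_s =>
    if mu \in msupp p
    then mcoeff mu p * \prod_i (c *: x + b) 0 i ^+ mu i else 0).
  by under eq_fun do rewrite big_mkcond/=; exact: polyfun_sum.
move=> mu; case mup: (mu \in msupp p); last exact: polyfun_leq (polyfun_cst 0).
apply: (polyfun_leq (k := (0 + mdeg mu)%N)).
  by rewrite add0n -ltnS (leq_trans _ pk)// msize_mdeg_lt.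
apply: polyfunM; first exact: polyfun_cst.
rewrite mdegE; apply: polyfun_prod => i.
rewrite -[X in polyfun X]muln1; apply: polyfun_exp.
under eq_fun do rewrite !mxE.
apply: polyfunD; last exact: polyfun_leq (polyfun_cst _).
exact: (polyfunM (polyfun_cst c) (polyfun_coord i)).
Qed.

Lemma polyfun_qprod (j : {ffun 'I_s -> nat}) :
  polyfun (\sum_i j i) (@qprod R s j).
Proof.
apply: polyfun_prod => i.
rewrite -[X in polyfun X]card_ord -sum1_card.
apply: polyfun_prod => l; apply: polyfunD; first exact: polyfun_coord.
exact: polyfun_leq (polyfun_cst _).
Qed.

Lemma polyfun_continuous k f : polyfun k f -> continuous f.
Proof.
move=> [p _ /funext ->]; under eq_fun do rewrite mevalE.
apply: continuous_big => [|mu _ x]; first apply: add_continuous.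
refine (@continuousM R 'rV[R]_s (fun=> mcoeff mu p)
  (fun x => \prod_i x 0 i ^+ mu i) x _ _).
  exact: cst_continuous.
move: x; apply: continuous_big => [|i _ x]; first exact: mul_continuous.
apply: (@continuous_comp _ _ _
  (fun x : 'rV[R]_s => x 0 i) (fun y => y ^+ mu i)).
  exact: coord_continuous.
exact: exprn_continuous.
Qed.

End PolynomialFunctions.

(** * Expansion in falling factorials *)

(** Stirling numbers of the second kind. *)
Fixpoint stirling (n l : nat) : nat :=
  match n, l with
  | 0, 0 => 1
  | 0, _.+1 => 0
  | _.+1, 0 => 0
  | n'.+1, l'.+1 => l * stirling n' l + stirling n' l'
  end%N.

Lemma stirling_small n l : (n < l)%N -> stirling n l = 0%N.
Proof.
by elim: n l => [|n IH] [|l]//= nl; rewrite !IH ?muln0// ltnW.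
Qed.

(** One step of the induction on [n] is
    [x (x)_l = (x)_(l+1) + l (x)_l], where [(x)_l = x (x - 1) ... (x - l + 1)];
    this is the recurrence of the Stirling numbers.  A range [N] independent of
    [n] allows all coordinates of a monomial to be expanded over one index
    type. *)
Lemma exp_falling (R : comPzRingType) (x : R) n N : (n <= N)%N ->
  x ^+ n = \sum_(l < N.+1) (stirling n l)%:R * \prod_(i < l) (x - i%:R).
Proof.
elim: n => [_|n IH nN].
  by rewrite big_ord_recl big_ord0 big1 ?addr0 ?mulr1// => i _; rewrite mul0r.
rewrite exprSr (IH (ltnW nN)) mulr_suml.
pose T l : R := \prod_(i < l) (x - i%:R).
transitivity (\sum_(l < N.+1) (stirling n l)%:R * T l.+1
            + \sum_(l < N.+1) (stirling n l)%:R * (l%:R * T l)).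
  rewrite -big_split; apply: eq_bigr => l _ /=.
  by rewrite /T big_ord_recr /=; ring.
rewrite big_ord_recr /= stirling_small// mul0r addr0.
rewrite [X in _ + X]big_ord_recl /= mul0r mulr0 add0r -big_split.
rewrite [RHS]big_ord_recl /= mul0r add0r; apply: eq_bigr => l _.
by rewrite /bump leq0n add0n add1n natrD natrM /T; ring.
Qed.

(** A product over the coordinates of the univariate expansions; an index [j]
    of degree above [k] exceeds every monomial of [f] in some coordinate, where
    the Stirling number vanishes. *)
Lemma polyfun_expand (R : realType) s k (f : 'rV[R]_s -> R) : polyfun k f ->
  exists c : {ffun 'I_s -> nat} -> R, exists2 r : seq {ffun 'I_s -> nat},
   (forall j, j \in r -> (\sum_i j i <= k)%N) &
   forall x, f x = \sum_(j <- r) c j * qprod j x.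
Proof.
move=> [p pk fE].
pose up (J : {ffun 'I_s -> 'I_k.+1}) := [ffun i => J i : nat].
pose deg (j : {ffun 'I_s -> nat}) := (\sum_i j i)%N.
pose c (j : {ffun 'I_s -> nat}) : R :=
  \sum_(mu <- msupp p) mcoeff mu p * \prod_i (stirling (mu i) (j i))%:R.
exists c, [seq j <- [seq up J | J <- enum {ffun 'I_s -> 'I_k.+1}]
  | (deg j <= k)%N].
  by move=> j; rewrite mem_filter => /andP[].
move=> x; rewrite fE mevalE big_filter [RHS]big_map [RHS]big_enum_cond /=.
under [RHS]eq_bigr do rewrite /c mulr_suml.
rewrite exchange_big /= big_seq [RHS]big_seq; apply: eq_bigr => mu mup.
have muk : (mdeg mu <= k)%N by rewrite -ltnS (leq_trans _ pk)// msize_mdeg_lt.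
have H i : x 0 i ^+ mu i = \sum_(l < k.+1) (stirling (mu i) l)%:R *
    \prod_(t < l) (x 0 i - t%:R).
  apply: exp_falling; rewrite (leq_trans _ muk)// mdegE.
  by rewrite (bigD1 i)//= leq_addr.
under eq_bigr do rewrite H.
rewrite bigA_distr_bigA mulr_sumr (bigID (fun J => deg (up J) <= k)%N)/=.
rewrite addrC big1 ?add0r.
  apply: eq_bigr => J _.
  rewrite -mulrA big_split/=; congr (_ * (_ * _)).
    by apply: eq_bigr => i _; rewrite ffunE.
  by rewrite /qprod; apply: eq_bigr => i _; rewrite ffunE.
move=> J degJ.
have [i iJ] : exists i, (mu i < J i)%N.
  apply/existsP; apply: contraR degJ; rewrite negb_exists => /forallP HJ.
  rewrite (leq_trans _ muk)// mdegE /deg leq_sum// => i _.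
  by rewrite ffunE leqNgt.
by rewrite (bigD1 i)//= stirling_small// !mul0r mulr0.
Qed.

(** * Reproduction as a condition on the residue classes of the mask *)

Section Reproduction.
Context {R : realType} {s : nat} {m : int}.
Context {a : 'rV[int]_s -> R} {tau : 'rV[R]_s}.
Hypotheses (m0 : m != 0) (ha : is_mask a).

(** From left to right, the two sides are data with the same limit function,
    and [non_singular] separates them.  From right to left, the identity is
    applied at level [r] to [x |-> p (t_0^(r) + x / m^r)], whose values on Z^s
    are the samples of [p] at the parameter values of that level. *)
Lemma reproduces_subdivP k : non_singular m a tau ->
  reproduces_polynomials m a tau k <->
  (forall f, polyfun k f -> forall alpha,
     subdiv m a (fun beta => f (map_mx intr beta)) alpha =
     f (m%:~R^-1 *: (map_mx intr alpha - tau))).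
Proof.
move=> [_ ns]; split=> [H f Pf alpha|H p pk p_fun].
  have repr g : polyfun k g ->
      limit_function m a tau (fun beta => g (map_mx intr beta)) g.
    move=> [p pk gE]; have := H p pk; rewrite /=.
    under [X in limit_function _ _ _ X _]eq_fun do rewrite param_level0 -gE.
    by under [X in limit_function _ _ _ _ X]eq_fun do rewrite -gE.
  pose g x := f (m%:~R^-1 *: (x - tau)).
  have Pg : polyfun k g.
    rewrite (_ : g = fun x => f (m%:~R^-1 *: x + - (m%:~R^-1 *: tau))).
      exact: polyfun_affine.
    by apply/funext => x; rewrite /g scalerBr.
  have L := limit_functionB m0 ha
    (limit_function_subdiv m0 (repr f Pf)) (repr g Pg).
  have [Z _] := ns _ _ L.
  by apply/eqP; rewrite -subr_eq0; apply/eqP; apply: Z => x /=; rewrite subrr.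
have Pp : polyfun k p_fun by exists p.
have iterE r alpha :
    iter_subdiv m a (fun beta => p_fun (param m tau 0 beta)) r alpha =
    p_fun (param m tau r alpha).
  elim: r alpha => [//|r IH] alpha.
  rewrite /iter_subdiv iterS -/(iter_subdiv _ _ _ _).
  have -> : iter_subdiv m a (fun beta => p_fun (param m tau 0 beta)) r =
      fun beta => p_fun ((m%:~R ^+ r)^-1 *: map_mx intr beta + param0 m tau r).
    by apply/funext => beta; rewrite IH /param addrC.
  rewrite (H _ (polyfun_affine _ _ Pp)).
  have cE : (m%:~R ^+ r.+1)^-1 = (m%:~R ^+ r)^-1 * m%:~R^-1 :> R.
    by rewrite exprSr invfM.
  congr p_fun; rewrite -[param m tau r.+1 alpha]/(param0 m tau r -
    (m%:~R ^+ r.+1)^-1 *: tau + (m%:~R ^+ r.+1)^-1 *: map_mx intr alpha).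
  by rewrite cE scalerA scalerBr addrAC [RHS]addrC addrA.
exists (fun=> p_fun); split.
- by move=> _; exact: polyfun_continuous Pp.
- by move=> r alpha; rewrite iterE.
- apply/cvg_compactP => A _ e e0; apply: nearW => n x _.
  by rewrite subrr normr0.
Qed.

(** The substitutions [x |-> alpha - m x] and [x |-> (alpha - x) / m] are
    inverse to each other and preserve degrees.  They carry the points
    [(alpha - gamma) / m] and [(alpha - tau) / m] to [gamma] and [tau] and
    back. *)
Lemma subdiv_coset_sumP k :
  (forall f, polyfun k f -> forall alpha,
     subdiv m a (fun beta => f (map_mx intr beta)) alpha =
     f (m%:~R^-1 *: (map_mx intr alpha - tau))) <->
  (forall f, polyfun k f -> forall alpha,
     \sum_(gamma <- mask_support a | congr_mod m alpha gamma)
        a gamma * f (map_mx intr gamma) = f tau).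
Proof.
have mR0 : m%:~R != 0 :> R by rewrite intr_eq0.
split=> H f Pf alpha.
  have E (x : 'rV[R]_s) : - m%:~R *: (m%:~R^-1 *: (map_mx intr alpha - x)) +
      map_mx intr alpha = x.
    by rewrite scalerA mulNr divff// scaleN1r opprB subrK.
  have := H _ (polyfun_affine (- m%:~R) (map_mx intr alpha) Pf) alpha.
  rewrite (subdiv_restr m0 ha
    (fun x => f (- m%:~R *: x + map_mx intr alpha))) E => <-.
  by apply: eq_bigr => gamma _; rewrite E.
have E (x : 'rV[R]_s) : - m%:~R^-1 *: x + m%:~R^-1 *: map_mx intr alpha =
    m%:~R^-1 *: (map_mx intr alpha - x).
  by rewrite scalerBr scaleNr addrC.
have := H _
  (polyfun_affine (- m%:~R^-1) (m%:~R^-1 *: map_mx intr alpha) Pf) alpha.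
by rewrite E subdiv_restr// => <-; apply: eq_bigr => gamma _; rewrite E.
Qed.

(** Both sides are linear in the polynomial, and the [q_j] span. *)
Lemma coset_momentsP k :
  (forall f, polyfun k f -> forall alpha,
     \sum_(gamma <- mask_support a | congr_mod m alpha gamma)
        a gamma * f (map_mx intr gamma) = f tau) <->
  (forall j : {ffun 'I_s -> nat}, (\sum_i j i <= k)%N -> forall alpha,
     \sum_(gamma <- mask_support a | congr_mod m alpha gamma)
        a gamma * qprod j (map_mx intr gamma) = qprod j tau).
Proof.
split=> [H j jk alpha|H f /polyfun_expand[c [r rk fE]] alpha].
  by apply: H; apply: polyfun_leq jk _; exact: polyfun_qprod.
under eq_bigr do rewrite fE mulr_sumr.
rewrite exchange_big fE big_seq [RHS]big_seq; apply: eq_bigr => j jr /=.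
rewrite -(H j (rk j jr) alpha) mulr_sumr.
by apply: eq_bigr => g _; rewrite mulrCA.
Qed.

End Reproduction.

(** * Roots of unity and the discrete Fourier transform on (Z/mZ)^s *)

Lemma expi0 (R : realType) : expi (0 : R) = 1.
Proof. by rewrite /expi cos0 sin0. Qed.

Lemma expiD (R : realType) (x y : R) : expi (x + y) = expi x * expi y.
Proof.
rewrite /expi cosD sinD; apply/eqP; rewrite eq_complex /=.
by rewrite eqxx /= addrC.
Qed.

Lemma expiMn (R : realType) (x : R) n : expi (x *+ n) = expi x ^+ n.
Proof.
by elim: n => [|n IH]; rewrite ?mulr0n ?expi0// mulrS expiD IH exprS.
Qed.

Lemma cos_lt1 (R : realType) (x : R) : 0 < x < 2 * pi -> cos x < 1.
Proof.
move=> /andP[x0 x2pi].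
have : 0 < sin (x / 2) by apply: sin_gt0_pi; apply/andP; split; lra.
rewrite [x in cos x](_ : x = (x / 2) *+ 2); last by rewrite -mulr_natr divfK.
rewrite cos_mulr2n cos2sin2 -mulr_natr => sin0; nra.
Qed.

(** The modulus [m] may be negative, in which case this is
    [exp (2 pi i / |m|)]. *)
Definition root_of_unity (R : realType) (m : int) : R[i] :=
  expi (- (2 * pi / m%:~R)).

Section RootsOfUnity.
Context {R : realType} {m : int}.
Hypothesis m0 : m != 0.
Let M := `|m|%N.
Local Notation w := (root_of_unity R m).

Lemma expi_root (n : nat) : expi (- (2 * pi * n%:R / m%:~R)) = w ^+ n :> R[i].
Proof.
by rewrite -expiMn; congr expi; rewrite -[RHS]mulr_natr mulNr [in RHS]mulrAC.
Qed.

(** Only real parts matter: the sign of [m] disappears in the cosine, which is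
    less than 1 strictly between 0 and [2 pi]. *)
Lemma prim_root_of_unity : M.-primitive_root w.
Proof.
have M0 : (0 < M)%N by rewrite absz_gt0.
have mE : m%:~R = M%:R :> R \/ m%:~R = - M%:R :> R.
  rewrite /M; case: (intP m) => [|n|n]; [by left|by left|right].
  by rewrite abszN mulrNz.
have cosE (n : nat) :
    cos (- (2 * pi * n%:R / m%:~R)) = cos (2 * pi * n%:R / M%:R) :> R.
  by rewrite cosN; case: mE => ->//; rewrite invrN mulrN cosN.
have MR0 : M%:R != 0 :> R by rewrite pnatr_eq0 -lt0n.
have wM : w ^+ M = 1.
  rewrite -expi_root; case: mE => ->; rewrite ?invrN ?mulrN ?opprK mulfK//.
    by rewrite /expi cosN sinN [2 * pi]mulr_natl cos2pi sin2pi oppr0.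
  by rewrite /expi [2 * pi]mulr_natl cos2pi sin2pi.
have wn n : (0 < n < M)%N -> w ^+ n != 1.
  move=> /andP[n0 nM].
  have : cos (- (2 * pi * n%:R / m%:~R)) < 1 :> R.
    have MRgt0 : 0 < M%:R :> R by rewrite ltr0n.
    have pi2 : 0 < 2 * pi :> R by rewrite mulr_gt0 ?pi_gt0.
    rewrite cosE cos_lt1// ltr_pdivrMr// ltr_pM2l// ltr_nat nM andbT.
    by rewrite divr_gt0// mulr_gt0// ltr0n.
  by rewrite -expi_root; apply: contraTneq => -[-> _]; rewrite ltxx.
rewrite /primitive_root_of_unity M0; apply/forallP => i.
rewrite unity_rootE; have := ltn_ord i; rewrite leq_eqVlt => /predU1P[->|iM].
  by rewrite wM !eqxx.
by rewrite (negbTE (wn _ _))// ltn_eqF.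
Qed.

Lemma root_of_unity_neq0 : w != 0.
Proof.
have /prim_expr_order wM := prim_root_of_unity.
apply/eqP => w0; move: wM; rewrite w0 expr0n absz_eq0 (negbTE m0) => /eqP.
by rewrite eq_sym oner_eq0.
Qed.

Lemma root_of_unity_exp_eq1 (n : int) : (w ^ n == 1) = (m %| n)%Z.
Proof.
rewrite dvdzE (prim_order_dvd prim_root_of_unity).
case: n => n; first by rewrite -exprnP.
by rewrite NegzE -exprnN abszN invr_eq1.
Qed.

(** A geometric sum, with ratio [w ^ n]. *)
Lemma sum_root_of_unity (n : int) :
  \sum_(x < M) (w ^+ x) ^ n = if (m %| n)%Z then M%:R else 0 :> R[i].
Proof.
under eq_bigr do rewrite exprnP exprzAC -exprnP.
case: ifPn => [|wn1].
  rewrite -root_of_unity_exp_eq1 => /eqP ->.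
  by under eq_bigr do rewrite expr1n; rewrite sumr_const card_ord.
apply/eqP; have := subrX1 (w ^ n) M.
rewrite [(w ^ n) ^+ M]exprnP exprzAC -[w ^ M]exprnP.
rewrite (prim_expr_order prim_root_of_unity) exp1rz subrr => /esym/eqP.
by rewrite mulf_eq0 subr_eq0 root_of_unity_exp_eq1 (negbTE wn1).
Qed.

(** The characters of (Z/mZ)^s, pulled back to Z^s; [chi e gamma] is also the
    value of the monomial [z^gamma] at the point of Xi with index [e]. *)
Definition chi s (e : {ffun 'I_s -> 'I_M}) (gamma : 'rV[int]_s) : R[i] :=
  \prod_i (w ^+ e i) ^ gamma 0 i.

Lemma chiB s (e : {ffun 'I_s -> 'I_M}) alpha gamma :
  chi e (alpha - gamma) = chi e alpha * chi e (- gamma).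
Proof.
rewrite /chi -big_split; apply: eq_bigr => i _ /=.
by rewrite !mxE expfzDr// expf_neq0// root_of_unity_neq0.
Qed.

Lemma chi_congr s (e : {ffun 'I_s -> 'I_M}) alpha gamma :
  congr_mod m alpha gamma -> chi e alpha = chi e gamma.
Proof.
move=> /forallP H; apply: eq_bigr => i _.
have /dvdzP[q qE] := H i.
rewrite -[alpha 0 i](subrK (gamma 0 i)) qE.
rewrite expfzDr ?expf_neq0 ?root_of_unity_neq0//.
rewrite [_ ^ (q * m)](_ : _ = 1) ?mul1r//.
have /eqP wqm : w ^ (q * m) == 1 by rewrite root_of_unity_exp_eq1 dvdz_mull.
by rewrite exprnP exprzAC wqm exp1rz.
Qed.

(** Orthogonality of characters: the sum over [e] is a product over the
    coordinates of the sums in [sum_root_of_unity]. *)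
Lemma sum_chi s (gamma : 'rV[int]_s) :
  \sum_e chi e gamma = if congr_mod m gamma 0 then M%:R ^+ s else 0.
Proof.
rewrite /chi -(bigA_distr_bigA (fun i (x : 'I_M) => (w ^+ x) ^ gamma 0 i)).
under eq_bigr do rewrite sum_root_of_unity.
case: ifPn => [/forallP H|].
  rewrite (eq_bigr (fun=> M%:R)) ?prodr_const ?card_ord// => i _.
  by have := H i; rewrite mxE subr0 => ->.
case/forallPn => i; rewrite mxE subr0 => /negbTE H.
by rewrite (bigD1 i)//= H mul0r.
Qed.

Definition residue s (x : {ffun 'I_s -> 'I_M}) : 'rV[int]_s :=
  \row_i (x i : nat)%:Z.

(** This symmetry makes [sum_chi] also the orthogonality relation for the sum
    over the group. *)
Lemma chi_residueC s (e x : {ffun 'I_s -> 'I_M}) :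
  chi e (residue x) = chi x (residue e).
Proof.
apply: eq_bigr => i _; rewrite !mxE -!exprnP -!exprM.
by rewrite mulnC.
Qed.

Lemma congr_residue0 s (e : {ffun 'I_s -> 'I_M}) :
  congr_mod m (residue e) 0 = [forall i, e i == 0%N :> nat].
Proof.
apply: eq_forallb => i; rewrite !mxE subr0 dvdzE /=.
have [->|ei0] := eqVneq (e i : nat) 0%N; first by rewrite dvdn0.
by rewrite gtnNdvd// lt0n.
Qed.

Lemma residue_uniq s (gamma : 'rV[int]_s) :
  exists x0, forall x, congr_mod m (residue x) gamma = (x == x0).
Proof.
have Hlt (n : int) : (`|(n %% m)%Z| < M)%N.
  by rewrite -ltz_nat !abszE ger0_norm ?modz_ge0// ltz_mod.
exists [ffun i => Ordinal (Hlt (gamma 0 i))] => x.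
apply/forallP/eqP => [H|-> i].
  apply/ffunP => i; apply/val_inj; rewrite ffunE /=.
  have := H i; rewrite !mxE -eqz_mod_dvd => /eqP <-.
  by rewrite -[(_ %% m)%Z]modz_abs modz_nat modn_small.
rewrite !mxE ffunE /= -eqz_mod_dvd abszE ger0_norm ?modz_ge0//.
by rewrite modz_mod.
Qed.

(** A function on a finite abelian group is the constant [v] if and only if
    its Fourier transform is [|G| v] at the trivial character and zero
    elsewhere; here the function sends a residue class to the sum of [b] over
    it.  Both directions insert an orthogonality relation and exchange sums. *)
Lemma coset_sums_fourierP s (r : seq 'rV[int]_s) (b : 'rV[int]_s -> R) (v : R) :
  (forall alpha, \sum_(gamma <- r | congr_mod m alpha gamma) b gamma = v) <->
  (forall e : {ffun 'I_s -> 'I_M},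
     \sum_(gamma <- r) (b gamma)%:C * chi e gamma =
     if [forall i, e i == 0%N :> nat] then (M%:R ^+ s * v)%:C else 0).
Proof.
split=> H.
  (* [x] ranges over the residue classes, each represented once. *)
  move=> e; transitivity (\sum_x chi e (residue x) * v%:C).
    transitivity (\sum_x \sum_(gamma <- r)
        if congr_mod m (residue x) gamma
        then chi e (residue x) * (b gamma)%:C else 0).
      rewrite exchange_big /=; apply: eq_bigr => gamma _.
      have [x0 Hx0] := residue_uniq gamma.
      rewrite -big_mkcond (big_pred1 x0)// mulrC (@chi_congr _ _ _ gamma)//.
      by rewrite Hx0.
    apply: eq_bigr => x _.
    by rewrite -(H (residue x)) rmorph_sum mulr_sumr [RHS]big_mkcond.
  rewrite -mulr_suml; under eq_bigr do rewrite chi_residueC.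
  rewrite sum_chi congr_residue0; case: ifP => _; last by rewrite mul0r.
  by rewrite rmorphM rmorphXn rmorph_nat.
move=> alpha.
have MC0 : (M%:R : R[i]) ^+ s != 0 by rewrite expf_neq0// pnatr_eq0 absz_eq0.
apply: (fmorph_inj (real_complex R)); apply: (mulIf MC0).
transitivity (\sum_e chi e (- alpha) *
  \sum_(gamma <- r) (b gamma)%:C * chi e gamma).
  under [RHS]eq_bigr do rewrite mulr_sumr.
  rewrite exchange_big /= rmorph_sum mulr_suml big_mkcond /=.
  apply: eq_bigr => gamma _.
  under [RHS]eq_bigr do rewrite mulrCA [chi _ (- alpha) * _]mulrC -chiB.
  rewrite -mulr_sumr sum_chi.
  rewrite (_ : congr_mod m (gamma - alpha) 0 = congr_mod m alpha gamma).
    by case: ifP => _; rewrite ?mulr0.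
  by apply: eq_forallb => i; rewrite !mxE subr0 -rpredN opprB.
under eq_bigr do rewrite H.
have M0 : (0 < M)%N by rewrite absz_gt0.
rewrite (bigD1 [ffun=> Ordinal M0])//= ifT; last first.
  by apply/forallP => i; rewrite ffunE.
rewrite big1 ?addr0 => [|e e0].
  rewrite /chi big1 ?mul1r; last by move=> i _; rewrite ffunE expr0 exp1rz.
  by rewrite rmorphM rmorphXn rmorph_nat mulrC.
rewrite ifF ?mulr0//; apply/negbTE; apply: contra e0 => /forallP e0.
by apply/eqP/ffunP => i; apply/val_inj; rewrite ffunE /=; exact/eqP.
Qed.

End RootsOfUnity.

(** * Partial derivatives of Laurent polynomials *)

Section LaurentDerivatives.
Context {K : numFieldType}.

Lemma is_derive_exprz (x : K) (n : int) : x != 0 ->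
  is_derive x 1 (fun y : K => y ^ n) (n%:~R * x ^ (n - 1)).
Proof.
move=> x0; have dX k : is_derive x 1 (fun y : K => y ^+ k) (k%:R * x ^+ k.-1).
  apply: DeriveDef; first exact: exprn_derivable.
  by rewrite exp_derive [_ *: 1]mulr1.
case: n => [[|k]|k].
- rewrite mul0r; have -> : (fun y : K => y ^ 0%:Z) = cst 1 by [].
  exact: is_derive_cst.
- by rewrite (_ : k.+1%:Z - 1 = k%:Z); [exact: (dX k.+1)|lia].
apply: DeriveDef.
  apply: (@derivableV K K (fun y => y ^+ k.+1)); first by rewrite expf_neq0.
  by have [] := dX k.+1.
rewrite (@deriveV K K (fun y => y ^+ k.+1)) ?expf_neq0//.
have [_ ->] := dX k.+1.
have -> : Negz k - 1 = - k.+2%:Z by lia.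
rewrite NegzE mulrNz mulNr [_ *: _]mulNr -exprnN; congr (- _).
have -> : (x ^+ k.+1) ^+ 2 = x ^+ k.+2 * x ^+ k.
  by rewrite -exprM -exprD; congr (_ ^+ _); lia.
by rewrite invfM mulrCA divfK ?expf_neq0.
Qed.

Lemma is_derive_sum_seq (I : Type) (r : seq I) (f : I -> K -> K)
    (df : I -> K) (x : K) :
  (forall i, is_derive x 1 (f i) (df i)) ->
  is_derive x 1 (fun y => \sum_(i <- r) f i y) (\sum_(i <- r) df i).
Proof.
move=> H; elim: r => [|i r IH].
  under eq_fun do rewrite big_nil; rewrite big_nil; exact: is_derive_cst.
under eq_fun do rewrite big_cons; rewrite big_cons; exact: is_deriveD.
Qed.

Lemma is_derive_translate (f : K -> K) (a df : K) :
  is_derive a 1 f df -> is_derive (0 : K) 1 (fun t => f (t + a)) df.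
Proof.
have E : (fun h => h^-1 *:
        (((fun t => f (t + a)) \o shift (0 : K)) (h *: 1) - f (0 + a)))
    = (fun h => h^-1 *: ((f \o shift a) (h *: 1) - f a)).
  by apply/funext => h /=; rewrite addr0 add0r.
by move=> [d v]; split; rewrite /derivable /derive E.
Qed.

Definition falling (n : int) (j : nat) : K := \prod_(l < j) (n%:~R - l%:R).

Lemma fallingS n j : falling n j.+1 = falling n j * (n - j%:Z)%:~R.
Proof. by rewrite /falling big_ord_recr /= intrB. Qed.

(** The [j]-th partial derivative of [sum c_gamma z^gamma], in the form that is
    stable under a further partial derivative. *)
Definition laurent s (r : seq 'rV[int]_s) (c : 'rV[int]_s -> K)
    (j : 'I_s -> nat) (z : 'rV[K]_s) : K :=
  \sum_(gamma <- r) c gamma *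
    \prod_i (falling (gamma 0 i) (j i) * z 0 i ^ (gamma 0 i - (j i)%:Z)).

Definition torus s : set 'rV[K]_s := [set z | forall i, z 0 i != 0].

(** The hypothesis is an equality on the torus only, since inverses at zero
    coordinates are meaningless.  The torus is open, so along the [i]-th
    coordinate line [f] still agrees with the Laurent polynomial near [z], and
    there each monomial is a constant times an integer power. *)
Lemma partial_laurent s (r : seq 'rV[int]_s) c j i (f : 'rV[K]_s -> K) :
  (forall z, torus z -> f z = laurent r c j z) ->
  forall z, torus z ->
    partial i f z = laurent r c (fun l => j l + (l == i))%N z.
Proof.
move=> fE z z0.
pose g t := f (t *: delta_mx 0 i + z).
have -> : partial i f z = 'D_1 g 0.
  rewrite /partial /derive.
  set g1 := fun h => h^-1 *: _; set g2 := fun h => h^-1 *: _.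
  suff -> : g1 = g2 by [].
  by apply/funext => h; rewrite /g1 /g2 /g /= addr0 scale0r add0r [_%:A]mulr1.
pose C gamma : K := c gamma * (falling (gamma 0 i) (j i) *
  \prod_(l | l != i)
    (falling (gamma 0 l) (j l) * z 0 l ^ (gamma 0 l - (j l)%:Z))).
pose p t : K :=
  \sum_(gamma <- r) C gamma * (t + z 0 i) ^ (gamma 0 i - (j i)%:Z).
have gp : {near (0 : K), g =1 p}.
  near=> t.
  have tz0 : t + z 0 i != 0.
    rewrite addrC -[t]opprK subr_eq0; near: t.
    exists `|z 0 i|; first by rewrite /= normr_gt0.
    move=> t /=; rewrite sub0r normrN; apply: contraTneq => ->.
    by rewrite normrN ltxx.
  rewrite /g fE; last first.
    move=> l; rewrite !mxE eqxx /=; case: (eqVneq l i) => [->|_].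
      by rewrite mulr1.
    by rewrite mulr0 add0r.
  apply: eq_bigr => gamma _; rewrite (bigD1 i)//= !mxE !eqxx /= mulr1.
  rewrite /C -!mulrA; congr (_ * (_ * _)); rewrite mulrC; congr (_ * _).
  apply: eq_bigr => l /negbTE li.
  by rewrite !mxE eqxx li mulr0 add0r.
rewrite (near_eq_derive _ gp)//.
have dp : is_derive (0 : K) 1 p (\sum_(gamma <- r) C gamma *
    ((gamma 0 i - (j i)%:Z)%:~R * z 0 i ^ (gamma 0 i - (j i)%:Z - 1))).
  apply: is_derive_sum_seq => gamma.
  exact: is_deriveZ (is_derive_translate (is_derive_exprz _ (z0 i))).
have [_ ->] := dp.
apply: eq_bigr => gamma _; rewrite [in RHS](bigD1 i)//= eqxx addn1 fallingS.
rewrite /C -!mulrA; congr (_ * (_ * _)).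
rewrite mulrC -!mulrA; congr (_ * (_ * _)).
  by rewrite -addrA -opprD -PoszD addn1.
by apply: eq_bigr => l /negbTE ->; rewrite addn0.
Unshelve. all: by end_near. Qed.

Lemma mpartial_laurent s (r : seq 'rV[int]_s) c (j : {ffun 'I_s -> nat}) f :
  (forall z, torus z -> f z = laurent r c (fun=> 0%N) z) ->
  forall z, torus z -> mpartial j f z = laurent r c j z.
Proof.
move=> f0.
have iterE i n g (k : 'I_s -> nat) :
    (forall z, torus z -> g z = laurent r c k z) ->
    forall z, torus z -> iter n (partial i) g z =
      laurent r c (fun l => k l + n * (l == i))%N z.
  move=> gE; elim: n => [|n IH] z zT.
    by rewrite /= gE//; congr laurent; apply/funext => l; rewrite mul0n addn0.
  rewrite iterS (partial_laurent _ IH)//; congr laurent; apply/funext => l.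
  by rewrite -addnA [(_ * _ + _)%N]addnC -mulSn.
rewrite /mpartial.
(* The induction runs over the coordinates already differentiated. *)
have -> : laurent r c j = laurent r c (fun l => (l \in enum 'I_s) * j l)%N.
  by congr laurent; apply/funext => l; rewrite mem_enum mul1n.
elim: (enum 'I_s) (enum_uniq 'I_s) => [_|i e IH /= /andP[ie ue]] z zT.
  by rewrite /= f0.
rewrite (iterE _ _ _ _ (IH ue))//; congr laurent; apply/funext => l.
rewrite inE; case: (eqVneq l i) => [->|_].
  by rewrite (negbTE ie) mul1n muln1.
by rewrite muln0 addn0.
Qed.

End LaurentDerivatives.

(** * The conditions on the symbol *)

Lemma symbol_laurent (R : realType) s (a : 'rV[int]_s -> R) z : is_mask a ->
  symbol a z =
  laurent (mask_support a) (fun gamma => (a gamma)%:C) (fun=> 0%N) z.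
Proof.
move=> ha; rewrite /symbol.
rewrite (fsbigE (mask_support a)) ?mask_support_uniq//; last first.
  by move=> gamma _ /(notin_mask_support ha) ->; rewrite mul0r.
rewrite big_mkcond; apply: eq_bigr => gamma _ /=.
rewrite mem_set//; congr (_ * _); apply: eq_bigr => i _.
by rewrite /falling big_ord0 mul1r subr0.
Qed.

Lemma qprod_falling (R : realType) s (j : {ffun 'I_s -> nat})
    (gamma : 'rV[int]_s) :
  (qprod j (map_mx intr gamma) : R)%:C =
  \prod_i falling (gamma 0 i) (j i) :> R[i].
Proof.
rewrite rmorph_prod; apply: eq_bigr => i _; rewrite rmorph_prod.
by apply: eq_bigr => l _; rewrite mxE rmorphB /= rmorph_int rmorph_nat.
Qed.

(** At the point [z] of Xi with index [e], the derivative [D^j a (z)] is the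
    Fourier coefficient at [chi e] of [a_gamma q_j(gamma)], up to the factor
    [z^(-j)], which is nonzero, and equal to 1 when [e = 0].  The indices
    [e != 0] are those of the points of Xi', since the root of unity is
    primitive. *)
Lemma symbol_conditionsP (R : realType) (s : nat) (m : int) (m0 : m != 0)
    (a : 'rV[int]_s -> R) (ha : is_mask a) (v : R) (j : {ffun 'I_s -> nat}) :
  (mpartial j (symbol a) (const_mx 1) = ((`|m|%N%:R ^+ s) * v)%:C /\
   (forall eps : 'rV[R[i]]_s, Xi' m eps -> mpartial j (symbol a) eps = 0)) <->
  (forall e : {ffun 'I_s -> 'I_`|m|%N}, \sum_(gamma <- mask_support a)
     (a gamma * qprod j (map_mx intr gamma))%:C * chi e gamma =
     if [forall i, e i == 0%N :> nat] then (`|m|%N%:R ^+ s * v)%:C else 0).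
Proof.
pose w : R[i] := root_of_unity R m.
pose pt (e : {ffun 'I_s -> 'I_`|m|%N}) : 'rV[R[i]]_s := \row_i w ^+ e i.
pose A (e : {ffun 'I_s -> 'I_`|m|%N}) := \sum_(gamma <- mask_support a)
     (a gamma * qprod j (map_mx intr gamma))%:C * chi e gamma.
have ptT e : torus (pt e).
  by move=> i; rewrite mxE expf_neq0// root_of_unity_neq0.
have DE e : mpartial j (symbol a) (pt e) = (\prod_i pt e 0 i ^- j i) * A e.
  rewrite (mpartial_laurent _ (fun z _ => symbol_laurent z ha) (ptT e)).
  rewrite /A mulr_sumr; apply: eq_bigr => gamma _.
  rewrite rmorphM /= qprod_falling big_split /= -!mulrA.
  rewrite [RHS]mulrCA; congr (_ * _); rewrite [RHS]mulrCA; congr (_ * _).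
  rewrite -big_split; apply: eq_bigr => i _ /=.
  by rewrite expfzDr ?ptT// mulrC exprnN mxE.
have pt1 (e : {ffun 'I_s -> 'I_`|m|%N}) :
    [forall i, e i == 0%N :> nat] -> pt e = const_mx 1.
  by move=> /forallP e0; apply/rowP => i; rewrite !mxE (eqP (e0 i)) expr0.
have pt_neq1 (e : {ffun 'I_s -> 'I_`|m|%N}) :
    ~~ [forall i, e i == 0%N :> nat] -> pt e <> const_mx 1.
  case/forallPn => i ei0 /rowP /(_ i) /eqP; rewrite !mxE.
  rewrite -(prim_order_dvd (prim_root_of_unity m0)) gtnNdvd// lt0n.
  exact: ei0.
have XiE eps : Xi m eps <-> exists e, eps = pt e.
  by split=> -[e ->]; exists e; apply/rowP => i; rewrite !mxE expi_root//.
split=> [[D1 D0] e|H].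
  case: ifPn => e0.
    have := DE e; rewrite pt1// D1 big1 ?mul1r//.
    by move=> i _; rewrite mxE expr1n invr1.
  have /eqP := D0 (pt e) (conj ((XiE _).2 (ex_intro _ e erefl)) (pt_neq1 e e0)).
  rewrite DE mulf_eq0 => /orP[/prodf_eq0[i _]|/eqP//].
  by rewrite invr_eq0 expf_eq0 (negbTE (ptT e i)) andbF.
split=> [|eps [/XiE[e ->] neq1]].
  have M0 : (0 < `|m|)%N by rewrite absz_gt0.
  pose e0 : {ffun 'I_s -> 'I_`|m|%N} := [ffun=> Ordinal M0].
  have e00 : [forall i, e0 i == 0%N :> nat].
    by apply/forallP => i; rewrite ffunE.
  have := H e0; rewrite e00 => <-; rewrite -(pt1 _ e00) DE big1 ?mul1r//.
  by move=> i _; rewrite pt1// mxE expr1n invr1.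
by rewrite DE /A H ifF ?mulr0//; apply/negP => /pt1.
Qed.

Theorem theorem2p6 (R : realType) (s : nat) (hs : (1 <= s)%N)
    (m : int) (hm : (2 <= `|m|)%N) (k : nat)
    (a : 'rV[int]_s -> R) (ha : is_mask a) (tau : 'rV[R]_s)
    (hns : non_singular m a tau) :
  reproduces_polynomials m a tau k <->
  (forall j : {ffun 'I_s -> nat}, (\sum_(i < s) j i <= k)%N ->
     mpartial j (symbol a) (const_mx 1) = ((`|m|%N%:R ^+ s) * qprod j tau)%:C /\
     (forall eps : 'rV[R[i]]_s, Xi' m eps ->
        mpartial j (symbol a) eps = 0)).
Proof.
have m0 : m != 0 by rewrite -absz_gt0 (leq_trans _ hm).
rewrite (reproduces_subdivP m0 ha _ hns) (subdiv_coset_sumP m0 ha).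
rewrite coset_momentsP//.
split=> H j jk.
  apply/(symbol_conditionsP m0 ha)/(coset_sums_fourierP m0) => alpha.
  exact: H.
by apply/(coset_sums_fourierP m0)/(symbol_conditionsP m0 ha)/H.
Qed.
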